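(* Let $\mathcal F=\{F^\lambda\}_{\lambda\in\Lambda}$ be a family of affine iterated function systems on $\mathbb R^d$ satisfying the standing assumptions of the context, let $\Omega$ be the associated space of code trees with neck lists, and let $\Xi:\Omega\to\Omega$ be the shift. Let $P$ be an ergodic $\Xi$-invariant Borel probability measure on $\Omega$ with $\int_\Omega N_1(\omega)\,dP(\omega)<\infty$. Then $\alpha^\omega=\tilde\alpha^\omega$ for $P$-almost all $\omega\in\Omega$, where $\alpha^\omega$ is the affinity dimension and $\tilde\alpha^\omega$ the neck affinity dimension of $\Sigma^\omega$.
   Context: Conventions: $\mathbb N=\{1,2,\dots\}$. Family of systems. $\Lambda$ is a topological space and for each $\lambda\in\Lambda$, $F^\lambda=\{f_i^\lambda=T_i^\lambda+a_i^\lambda\}_{i=1}^{M_\lambda}$ ($M_\lambda\ge1$) is an affine iterated function system on $\mathbb R^d$, with $T_i^\lambda:\mathbb R^d\to\mathbb R^d$ linear and non-singular and $a_i^\lambda\in\mathbb R^d$. Standing assumptions: $\sup_{\lambda,i}|a_i^\lambda|<\infty$; $M=\sup_\lambda M_\lambda<\infty$; there are $\underline\sigma,\overline\sigma\in(0,1)$ with $\underline\sigma\le\sigma_d(T_i^\lambda)\le\dots\le\sigma_1(T_i^\lambda)=\|T_i^\lambda\|\le\overline\sigma$ for all $\lambda\in\Lambda$, $1\le i\le M_\lambda$, where $\sigma_j(T)$ is the $j$-th singular value; the map $\lambda\mapsto F^\lambda\in\bigcup_{i=1}^M\mathbb R^{(d^2+d)i}$ (disjoint union) is Borel measurable. Singular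 value function. For $0\le s<d$, $\Phi^s(T)=\sigma_1(T)\cdots\sigma_{m-1}(T)\sigma_m(T)^{s-m+1}$ where $m$ is the integer with $m-1\le s<m$; for $s\ge d$, $\Phi^s(T)=\sigma_1(T)\cdots\sigma_{d-1}(T)\sigma_d(T)^{s-d+1}$. Code trees. Let $I=\{1,\dots,M\}$, $I^0=\{\emptyset\}$. For $\tilde\omega:\bigcup_{k\ge0}I^k\to\Lambda$ let $\Sigma_*^{\tilde\omega}\subset\bigcup_{k\ge0}I^k$ be the unique set of words with: $\emptyset\in\Sigma_*^{\tilde\omega}$; if $i_1\cdots i_k\in\Sigma_*^{\tilde\omega}$ and $\tilde\omega(i_1\cdots i_k)=\lambda$ then $i_1\cdots i_kl\in\Sigma_*^{\tilde\omega}$ iff $l\le M_\lambda$; if $i_1\cdots i_k\notin\Sigma_*^{\tilde\omega}$ then $i_1\cdots i_kl\notin\Sigma_*^{\tilde\omega}$ for all $l$. The restriction of $\tilde\omega$ to $\Sigma_*^{\tilde\omega}$ is called a code tree (also denoted $\tilde\omega$); $\widetilde\Omega$ is the set of code trees. Let $\Sigma^{\tilde\omega}=\{\mathbf i=i_1i_2\cdots\in I^{\mathbb N}: i_1\cdots i_n\in\Sigma_*^{\tilde\omega}\ \forall n\}$. Write $\mathbf i_k$ for a word of length $k$, and $[\mathbf i_k]=\{\mathbf j\in\Sigma^{\tilde\omega}: j_l=i_l,\ l=1,\dots,k\}$ for the cylinder it determines. Set $T^{\tilde\omega}_{\mathbf i_k}=T_{i_1}^{\tilde\omega(\emptyset)}T_{i_2}^{\tilde\omega(i_1)}\cdots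 T_{i_k}^{\tilde\omega(i_1\cdots i_{k-1})}$. Neck lists. $\Omega$ is the set of pairs $\omega=(\tilde\omega,\mathbf N)$ with $\tilde\omega\in\widetilde\Omega$ and $\mathbf N=(N_m)_{m\in\mathbb N}$ a strictly increasing sequence of natural numbers (a neck list) such that: if $\mathbf i_{N_m}\mathbf j_l,\ \mathbf i'_{N_m}\in\Sigma_*^{\tilde\omega}$ (words of lengths $N_m+l$ and $N_m$, $l\ge0$), then $\mathbf i'_{N_m}\mathbf j_l\in\Sigma_*^{\tilde\omega}$ and $\tilde\omega(\mathbf i_{N_m}\mathbf j_l)=\tilde\omega(\mathbf i'_{N_m}\mathbf j_l)$. Write $N_m(\omega)=N_m$, and $\Sigma^\omega_*,\Sigma^\omega,T^\omega$, etc. for the corresponding objects of $\tilde\omega$. The shift is $\Xi(\tilde\omega,\mathbf N)=(\hat\omega,\hat{\mathbf N})$ with $\hat N_m=N_{m+1}-N_1$ and $\hat\omega(\mathbf j_l)=\tilde\omega(\mathbf i_{N_1}\mathbf j_l)$ (independent of the choice of $\mathbf i_{N_1}\in\Sigma_*^{\tilde\omega}$). $\Omega$ carries the topology generated by the cylinders $\{(\hat\omega,\hat{\mathbf N})\in\Omega:\hat N_i=N_i\ \forall i\le m,\ \hat\omega(\tau)=\tilde\omega(\tau)\ \forall\,|\tau|<N_m\}$, and its Borel $\sigma$-algebra. Affinity dimension. For $s\ge0$ and Borel $E\subset\Sigma^\omega$ let $\mathcal M^s(E)=\lim_{j\to\infty}\mathcal M^s_j(E)$, where $\mathcal M^s_j(E)=\inf\{\sum_{\mathbf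 i\in J}\Phi^s(T^\omega_{\mathbf i}): J\subset\Sigma_*^\omega,\ E\subset\bigcup_{\mathbf i\in J}[\mathbf i],\ \text{every word in }J\text{ has length}\ge j\}$. The affinity dimension is $\alpha^\omega=\inf\{s\ge0:\mathcal M^s(\Sigma^\omega)=0\}=\sup\{s\ge0:\mathcal M^s(\Sigma^\omega)=\infty\}$ (with $\sup\emptyset=0$). Neck affinity dimension. For $n\in\mathbb N$ let $I_n=\{\mathbf i_{N_k(\omega)}\in\Sigma_*^\omega: k\ge n\}$ (all words of $\Sigma_*^\omega$ whose length is $N_k(\omega)$ for some $k\ge n$). For $s\ge0$ and Borel $E\subset\Sigma^\omega$ let $\widetilde{\mathcal M}^s(E)=\lim_{j\to\infty}\widetilde{\mathcal M}^s_j(E)$, where $\widetilde{\mathcal M}^s_j(E)=\inf\{\sum_{\mathbf i\in J}\Phi^s(T^\omega_{\mathbf i}): J\subset I_j,\ E\subset\bigcup_{\mathbf i\in J}[\mathbf i]\}$. The neck affinity dimension is $\tilde\alpha^\omega=\inf\{s\ge0:\widetilde{\mathcal M}^s(\Sigma^\omega)=0\}=\sup\{s\ge0:\widetilde{\mathcal M}^s(\Sigma^\omega)=\infty\}$ (with $\sup\emptyset=0$). *)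

(* Defs.v *)
From HB Require Import structures.
From mathcomp Require Import all_boot all_order all_algebra.
From mathcomp Require Import all_classical all_reals all_analysis.
From mathcomp Require Import finmap polyrcf.
Set Implicit Arguments.
Unset Strict Implicit.
Unset Printing Implicit Defensive.
Import Order.TTheory GRing.Theory Num.Theory.
Import numFieldNormedType.Exports.
Local Open Scope classical_set_scope.
Local Open Scope ring_scope.

Definition enorm (R : realType) (d : nat) (v : 'cV[R]_d) : R :=
  Num.sqrt (\sum_j v j 0 ^+ 2).

(* [rootsR] lists the distinct real roots of a polynomial in increasing order;
   each one is repeated according to its multiplicity. *)
Definition eigvals_mult (R : realType) (d : nat) (A : 'M[R]_d) : seq R :=
  flatten [seq nseq (mup x (char_poly A)) x | x <- rootsR (char_poly A)].

Definition singvals (R : realType) (d : nat) (T : 'M[R]_d) : seq R :=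
  [seq Num.sqrt x | x <- rev (eigvals_mult (T^T *m T))].

(* 0-based: [singval T j] is $\sigma_{j+1}(T)$. *)
Definition singval (R : realType) (d : nat) (T : 'M[R]_d) (j : nat) : R :=
  (singvals T)`_j.

(* With k = m - 1, both cases of the definition read
   $\sigma_1 \cdots \sigma_k \sigma_{k+1}^{s-k}$, where k is the integer part
   of s if s < d, and k = d - 1 if s >= d. *)
Definition svf (R : realType) (d : nat) (s : R) (T : 'M[R]_d) : R :=
  let k := minn (Num.truncn s) d.-1 in
  (\prod_(j < k) singval T j) * singval T k `^ (s - k%:R).

Definition ifs_space (R : realType) (d n : nat) : topologicalType :=
  'M[R]_(n, d * d + d).

(* The system of index [l] as a point of the disjoint union of the spaces
   $\mathbb{R}^{(d^2+d)n}$; row [i] holds the entries of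
   the [i]-th linear part followed by those of the [i]-th translation. *)
Definition ifs_point (R : realType) (d : nat) (L : Type) (nmaps : L -> nat)
    (lin : L -> nat -> 'M[R]_d) (trans : L -> nat -> 'cV[R]_d) (l : L) :
    {n : nat & ifs_space R d n} :=
  existT (fun n => ifs_space R d n : Type) (nmaps l)
    (\matrix_(i < nmaps l) row_mx (mxvec (lin l i)) (trans l i)^T).

Definition borel_map (X Y : topologicalType) (f : X -> Y) : Prop :=
  forall B : set Y, <<s open >> B -> <<s open >> (f @^-1` B).

(* Maps are numbered from 0: $f_{i+1}^\lambda = $ [lin l i] $+$ [trans l i] for
   [i < nmaps l]; the values for larger [i] are irrelevant. The parameter space
   is pointed, i.e. nonempty, because measurable types are. *)
Record affine_family (R : realType) (d : nat) (L : ptopologicalType) := {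
  nmaps : L -> nat ;
  lin : L -> nat -> 'M[R]_d ;
  trans : L -> nat -> 'cV[R]_d ;
  nmaps_gt0 : forall l, (0 < nmaps l)%N ;
  lin_unit : forall l i, (i < nmaps l)%N -> lin l i \in unitmx ;
  trans_bounded : exists C : R, forall l i, (i < nmaps l)%N ->
    enorm (trans l i) <= C ;
  nmaps_bounded : exists M : nat, forall l, (nmaps l <= M)%N ;
  singval_bounded : exists lo hi : R, [/\ 0 < lo < 1, 0 < hi < 1 &
    forall l i j, (i < nmaps l)%N -> (j < d)%N ->
      lo <= singval (lin l i) j <= hi] ;
  ifs_borel : borel_map (ifs_point nmaps lin trans)
}.

(* A code tree is a labelling restricted to its own set of words, i.e. a partial
   function [t] whose domain is that set ([None] outside it). Letters are
   numbered from 0. *)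
Definition is_code_tree (R : realType) (d : nat) (L : ptopologicalType)
    (F : affine_family R d L) (t : seq nat -> option L) : Prop :=
  isSome (t [::]) /\
  forall w i, isSome (t (rcons w i)) =
              (if t w is Some l then (i < nmaps F l)%N else false).

(* [neck m] is $N_m$ for m >= 1; the convention $N_0 = 0$ makes strict
   monotonicity also say that $N_1 >= 1$. *)
Record necked_tree (R : realType) (d : nat) (L : ptopologicalType)
    (F : affine_family R d L) := NeckedTree {
  tree : seq nat -> option L ;
  neck : nat -> nat ;
  tree_code : is_code_tree F tree ;
  neck0 : neck 0 = 0%N ;
  neck_incr : forall m, (neck m < neck m.+1)%N ;
  neck_prop : forall m (w w' v : seq nat), (0 < m)%N ->
    size w = neck m -> size w' = neck m ->
    isSome (tree (w ++ v)) -> isSome (tree w') ->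
    isSome (tree (w' ++ v)) /\ tree (w ++ v) = tree (w' ++ v)
}.

Section NeckedTree.
Context (R : realType) (d : nat) (L : ptopologicalType).
Variable F : affine_family R d L.
Local Notation Omega := (necked_tree F).
Implicit Types (om : Omega) (w : seq nat) (s : R).

Lemma necked_tree_eq om om' :
  tree om = tree om' -> neck om = neck om' -> om = om'.
Proof.
case: om om' => t N a b c e [t' N' a' b' c' e'] /= tt NN.
by subst t' N'; congr NeckedTree; exact: Prop_irrelevance.
Qed.

Lemma tree_cat om w v : isSome (tree om (w ++ v)) -> isSome (tree om w).
Proof.
elim/last_ind: v => [|v i IH]; first by rewrite cats0.
rewrite -rcons_cat (tree_code om).2.
by case E: (tree om (w ++ v)) IH => [l|] //= IH _; exact: IH.
Qed.

Lemma tree_nseq0 om n : isSome (tree om (nseq n 0%N)).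
Proof.
elim: n => [|n IH]; first exact: (tree_code om).1.
have -> : nseq n.+1 0%N = rcons (nseq n 0%N) 0%N.
  by rewrite -cats1 -(addn1 n) nseqD.
rewrite (tree_code om).2.
by case: (tree om _) IH => // l _; exact: nmaps_gt0.
Qed.

Lemma neck_leq om m n : (m <= n)%N -> (neck om m <= neck om n)%N.
Proof.
by apply: (homo_leq leqnn leq_trans) => k; exact/ltnW/neck_incr.
Qed.

(* Every system is nonempty, so the word 0...0 is always a prefix to which
   the shift can be applied; by [shift_treeE] any other word of length $N_1$
   gives the same result. *)
Definition shift_tree om (v : seq nat) : option L :=
  tree om (nseq (neck om 1) 0%N ++ v).

Definition shift_neck om (m : nat) : nat := (neck om m.+1 - neck om 1)%N.

Lemma shift_treeE om w v : size w = neck om 1 -> isSome (tree om w) ->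
  shift_tree om v = tree om (w ++ v).
Proof.
move=> sw tw; rewrite /shift_tree.
have z1 := tree_nseq0 om (neck om 1).
have sz : size (nseq (neck om 1) 0%N) = neck om 1 by rewrite size_nseq.
case E: (tree om (w ++ v)) => [l|].
  have [] := neck_prop (isT : 0 < 1)%N sw sz (v := v) _ z1; first by rewrite E.
  by rewrite E.
case E': (tree om _) => [l|] //.
have [] := neck_prop (isT : 0 < 1)%N sz sw (v := v) _ tw; first by rewrite E'.
by rewrite E.
Qed.

Lemma shift_tree_code om : is_code_tree F (shift_tree om).
Proof.
split=> [|w i]; first by rewrite /shift_tree cats0 tree_nseq0.
by rewrite /shift_tree -rcons_cat (tree_code om).2.
Qed.

Lemma shift_neck0 om : shift_neck om 0 = 0%N.
Proof. by rewrite /shift_neck subnn. Qed.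

Lemma shift_neck_incr om m : (shift_neck om m < shift_neck om m.+1)%N.
Proof. by rewrite ltn_sub2rE ?neck_incr// neck_leq. Qed.

Lemma shift_neck_prop om m (w w' v : seq nat) : (0 < m)%N ->
  size w = shift_neck om m -> size w' = shift_neck om m ->
  isSome (shift_tree om (w ++ v)) -> isSome (shift_tree om w') ->
  isSome (shift_tree om (w' ++ v)) /\
  shift_tree om (w ++ v) = shift_tree om (w' ++ v).
Proof.
move=> _ sw sw'; rewrite /shift_tree !catA.
by apply: (@neck_prop _ _ _ _ om m.+1) => //;
  rewrite size_cat size_nseq ?sw ?sw' subnKC// neck_leq.
Qed.

Definition neck_shift om : Omega :=
  NeckedTree (shift_tree_code om) (shift_neck0 om) (shift_neck_incr om)
    (@shift_neck_prop om).

Definition point_tree (w : seq nat) : option L :=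
  if all (fun i => i < nmaps F point)%N w then Some point else None.

Lemma point_tree_code : is_code_tree F point_tree.
Proof.
split=> // w i; rewrite /point_tree all_rcons.
by case: (all _ w); rewrite ?andbT ?andbF//; case: ifP.
Qed.

Lemma point_tree_neck m (w w' v : seq nat) : (0 < m)%N ->
  size w = m -> size w' = m ->
  isSome (point_tree (w ++ v)) -> isSome (point_tree w') ->
  isSome (point_tree (w' ++ v)) /\ point_tree (w ++ v) = point_tree (w' ++ v).
Proof.
move=> _ _ _; rewrite /point_tree !all_cat.
by case: (all _ w); case: (all _ v); case: (all _ w').
Qed.

Definition point_necked : Omega :=
  NeckedTree (neck := id) point_tree_code erefl ltnSn point_tree_neck.

Definition cylinder (p : Omega * nat) : set Omega :=
  [set om | (forall k, (1 <= k <= p.2)%N -> neck om k = neck p.1 k) /\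
            (forall w, (size w < neck p.1 p.2)%N -> tree om w = tree p.1 w)].

HB.instance Definition _ := gen_eqMixin Omega.
HB.instance Definition _ := gen_choiceMixin Omega.
HB.instance Definition _ := isPointed.Build Omega point_necked.
HB.instance Definition _ := @isSubBaseTopological.Build Omega
  (Omega * nat)%type [set p | (0 < p.2)%N] cylinder.

Lemma cylinder_open om m : (0 < m)%N -> open (cylinder (om, m)).
Proof.
move=> m0; exists [set cylinder (om, m)]; last first.
  by rewrite predeqE => ?; split=> [[_ ->]|] //; exists (cylinder (om, m)).
move=> _ ->; exists [fset (om, m)]%fset.
  by move=> p; rewrite in_fset1 => /eqP ->; apply/mem_set.
rewrite predeqE => om'; split=> [/(_ (om, m))|h p /=].
  by apply; rewrite /= in_fset1.
by rewrite in_fset1 => /eqP ->.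
Qed.

Lemma neck_shift_continuous : continuous neck_shift.
Proof.
move=> om A /=; rewrite nbhsE => -[_ [[B sB <-] [C BC Cs] sBA]].
suff : nbhs om (neck_shift @^-1` C).
  by apply: filterS => om' om'C; apply: sBA; exists C.
have /sB [D sD IDeC] := BC; rewrite -IDeC.
have -> : neck_shift @^-1` (\bigcap_(i in [set` D]) cylinder i) =
   \bigcap_(i in [set` D]) (neck_shift @^-1` cylinder i) by [].
apply: filter_bigI => -[om1 m] Dm.
have m0 : (0 < m)%N by have /set_mem := sD _ Dm.
have [sn st] : cylinder (om1, m) (neck_shift om) 
  by move: Cs; rewrite -IDeC => /(_ _ Dm).
have om_c : cylinder (om, m.+1) om by split.
apply: filterS (open_nbhs_nbhs (conj (cylinder_open om (ltn0Sn m)) om_c)).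
move=> om2 [n2 t2] /=.
have n21 : neck om2 1 = neck om 1 by apply: n2.
split=> /= [k /andP[k1 km]|w sw].
  by rewrite -(sn k) ?k1 //= /shift_neck n21 n2.
have nm : neck om1 m = (neck om m.+1 - neck om 1)%N.
  by rewrite -(sn m) // m0 /=.
rewrite -(st w) //= /shift_tree n21 t2 //= size_cat size_nseq.
by rewrite -ltn_subRL -nm.
Qed.

Definition words om : set (seq nat) := [set w | isSome (tree om w)].

Definition prefix_of (r : nat -> nat) (k : nat) : seq nat := mkseq r k.

Definition rays om : set (nat -> nat) :=
  [set r | forall n, words om (prefix_of r n)].

Definition word_cylinder om w : set (nat -> nat) :=
  [set r | rays om r /\ prefix_of r (size w) = w].

(* The factors are multiplied in increasing order of k. The default [point] is
   never reached when w is a word of the tree. *)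
Definition word_lin om w : 'M[R]_d :=
  \big[mulmx/1%:M]_(k < size w)
    lin F (odflt point (tree om (take k w))) (nth 0%N w k).

Definition cover_inf om s (A : set (seq nat)) (E : set (nat -> nat)) : \bar R :=
  ereal_inf [set (\esum_(w in J) (svf s (word_lin om w))%:E)%E | J in
    [set J : set (seq nat) |
       J `<=` A /\ E `<=` \bigcup_(w in J) word_cylinder om w]].

Definition net_measure om s (E : set (nat -> nat)) : \bar R :=
  limn (fun j : nat => cover_inf om s (words om `&` [set w | (j <= size w)%N]) E).

Definition affinity_dim om : \bar R :=
  ereal_inf [set s%:E | s in [set s : R |
    0 <= s /\ net_measure om s (rays om) = 0%E]].

Definition neck_words om (n : nat) : set (seq nat) :=
  words om `&` [set w | exists2 k, (n <= k)%N & size w = neck om k].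

Definition neck_net_measure om s (E : set (nat -> nat)) : \bar R :=
  limn (fun j : nat => cover_inf om s (neck_words om j) E).

Definition neck_affinity_dim om : \bar R :=
  ereal_inf [set s%:E | s in [set s : R |
    0 <= s /\ neck_net_measure om s (rays om) = 0%E]].

End NeckedTree.

Definition borelType (T : ptopologicalType) := g_sigma_algebraType (@open T).

(* The maps below are not assumed measurable; [neck_shift] is continuous by
   [neck_shift_continuous]. *)
Definition invariant_measure (d : measure_display) (T : measurableType d)
    (R : realType) (P : probability T R) (f : T -> T) : Prop :=
  forall A, measurable A -> P (f @^-1` A) = P A.

Definition ergodic (d : measure_display) (T : measurableType d)
    (R : realType) (P : probability T R) (f : T -> T) : Prop :=
  forall A, measurable A -> f @^-1` A = A -> P A = 0%E \/ P A = 1%E.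

(* Main.v *)
(** Every neck cover is a cover, so one inequality is immediate. For the other
    one, extend each word w of a cover by long words up to the next neck level.
    The gaps N_(n+1) - N_n are distributed like the integrable N_1, so by
    Borel-Cantelli they are almost surely o(n). Hence w is extended by
    l = o(|w|) letters, which multiplies the number of words by at most M^l and
    does not increase the singular value function. Raising the exponent from s
    to t > s gains a factor of at most c^((t - s) |w|), where c < 1 bounds the
    norms of the maps; this absorbs M^l. *)
From HB Require Import structures.
Require Import Defs.
From mathcomp Require Import all_boot all_order all_algebra.
From mathcomp Require Import all_classical all_reals all_analysis.
From mathcomp Require Import perm measurable_realfun polyrcf complex ring zify.
Set Implicit Arguments.
Unset Strict Implicit.
Unset Printing Implicit Defensive.
Import Order.TTheory GRing.Theory Num.Theory.
Import numFieldNormedType.Exports.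
Local Open Scope classical_set_scope.
Local Open Scope ring_scope.

(** * Singular values *)

Lemma count_mem_flatten_nseq (T : eqType) (m : T -> nat) (s : seq T) x :
  uniq s -> count_mem x (flatten [seq nseq (m y) y | y <- s]) =
            if x \in s then m x else 0%N.
Proof.
elim: s => //= y s IH /andP[ys us]; rewrite count_cat count_nseq IH// inE /=.
rewrite [y == x]eq_sym; case: eqVneq => [->|xy] /=; last by rewrite mul0n add0n.
by rewrite (negbTE ys) mul1n addn0.
Qed.

Lemma mup_prod_XsubC (K : fieldType) (r : seq K) x :
  mup x (\prod_(y <- r) ('X - y%:P)) = count_mem x r.
Proof.
elim: r => [|y r IH]; first by rewrite big_nil mupNroot// root1.
rewrite big_cons mupM ?polyXsubC_eq0//; last first.
  by rewrite monic_neq0// monic_prod_XsubC.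
by rewrite IH -['X - _]expr1 mup_XsubCX /=; case: eqP.
Qed.

(** Conjugation by P commutes with the scalar matrix of the indeterminate, and the determinants of P
    and its inverse cancel. *)
Lemma char_poly_similar (K : fieldType) n (P A B : 'M[K]_n) : P \in unitmx ->
  A = invmx P *m B *m P -> char_poly A = char_poly B.
Proof.
move=> Pu ->; rewrite /char_poly.
pose c (X : 'M[K]_n) := map_mx polyC X.
have cVc : c (invmx P) *m c P = 1%:M by rewrite /c -map_mxM mulVmx// map_mx1.
have -> : char_poly_mx (invmx P *m B *m P) =
          c (invmx P) *m char_poly_mx B *m c P.
  rewrite /char_poly_mx mulmxBr mulmxBl /c !map_mxM; congr (_ - _).
  by rewrite scalar_mxC -mulmxA cVc mulmx1.
by rewrite !det_mulmx mulrAC -det_mulmx cVc det1 mul1r.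
Qed.

Section Singval.
Local Open Scope sesquilinear_scope.
Variable R : realType.
Implicit Types (d : nat).

(** Each x occurs in both lists as often as its multiplicity as a root, so any splitting into linear
    factors recovers [eigvals_mult]. *)
Lemma eigvals_mult_perm d (A : 'M[R]_d) (r : seq R) :
  char_poly A = \prod_(x <- r) ('X - x%:P) -> perm_eq (eigvals_mult A) r.
Proof.
move=> Ar; apply/allP => x _ /=; apply/eqP.
rewrite count_mem_flatten_nseq ?uniq_roots// {2}Ar mup_prod_XsubC.
have A0 : char_poly A != 0 by rewrite monic_neq0// char_poly_monic.
rewrite -roots_on_rootsR// in_itv /= Ar root_prod_XsubC.
by case: ifPn => // /count_memPn.
Qed.

Lemma eigvals_mult_sorted d (A : 'M[R]_d) : sorted <=%R (eigvals_mult A).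
Proof.
have : sorted <%R (rootsR (char_poly A)) by exact: sorted_roots.
rewrite /eigvals_mult (sorted_pairwise lt_trans) (sorted_pairwise le_trans).
elim: (rootsR _) => //= x s IH /andP[xs /IH ss].
rewrite pairwise_cat ss andbT; apply/andP; split; last first.
  elim: (mup _ _) => //= n ->; rewrite andbT.
  by apply/allP => y; rewrite mem_nseq => /andP[_ /eqP->].
apply/allrelP => y z; rewrite mem_nseq => /andP[_ /eqP->].
move=> /flattenP[_ /mapP[u us ->]]; rewrite mem_nseq => /andP[_ /eqP->].
by have /allP/(_ _ us)/ltW := xs.
Qed.

Local Notation toC := (real_complex R).

Lemma trmxC_toC m n (A : 'M[R]_(m, n)) :
  (map_mx toC A)^t* = map_mx toC A^T.
Proof.
by apply/matrixP => i j; rewrite !mxE; apply/CrealP; rewrite complex_real.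
Qed.

(** The complexified Gram matrix is Hermitian, so a unitary matrix diagonalizes it with real
    eigenvalues. These are the roots of the characteristic polynomial; permuting the rows of the
    unitary matrix puts them in the order of [singvals]. *)
Lemma singval_spectral d (T : 'M[R]_d) : exists2 U : 'M[R[i]]_d,
  U \is unitarymx & map_mx toC (T^T *m T) =
    U^t* *m diag_mx (\row_j toC (singval T j ^+ 2)) *m U.
Proof.
set S := map_mx toC (T^T *m T).
have Sherm : S \is hermsymmx.
  apply/is_hermitianmxP; rewrite expr0 scale1r [RHS]trmxC_toC.
  by rewrite trmx_mul trmxK.
have /orthomx_spectralP := hermitian_normalmx Sherm.
have := hermitian_spectral_diag_real Sherm.
have := spectral_unitarymx S.
move: (spectralmx S) (spectral_diag S) => P D Pu Dr SE.
have [r rE] : exists r : d.-tuple R, forall j, toC (tnth r j) = D 0 j.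
  exists [tuple complex.Re (D 0 j) | j < d] => j.
  by rewrite tnth_mktuple RRe_real//; apply/mxOverP.
have Ar : char_poly (T^T *m T) = \prod_(x <- r) ('X - x%:P).
  apply: (@map_poly_inj _ _ toC); rewrite map_char_poly -/S.
  rewrite (char_poly_similar (unitarymx_unit Pu) SE).
  rewrite char_poly_trig; last first.
    by apply/is_trig_mxP => i j ij; rewrite mxE -val_eqE (ltn_eqF ij).
  rewrite rmorph_prod/= big_tuple; apply: eq_bigr => j _.
  by rewrite rmorphB/= map_polyX map_polyC/= rE mxE eqxx.
have pe : perm_eq (rev (eigvals_mult (T^T *m T))) r.
  by rewrite perm_rev eigvals_mult_perm.
have /tuple_permP[p pE] := pe.
(* The diagonal matrix has the form Q Q^*, so its entries are nonnegative and squaring the roots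
   taken in [singvals] gives them back. *)
have rge0 j : 0 <= tnth r j.
  rewrite -ler0c rE.
  have -> : D 0 j = (diag_mx D) j j by rewrite mxE eqxx.
  pose Q := P *m map_mx toC T^T.
  have -> : diag_mx D = Q *m Q^t*.
    rewrite /Q trmx_mul map_mxM /= trmxC_toC trmxK mulmxA -(mulmxA P) -map_mxM.
    rewrite -/S SE invmx_unitary// !mulmxA (unitarymxP Pu) mul1mx.
    by rewrite mulmxtVK.
  by rewrite mxE sumr_ge0// => k _; rewrite !mxE mul_conjC_ge0.
have singvalE (j : 'I_d) : singval T j ^+ 2 = tnth r (p j).
  rewrite /singval /singvals pE (nth_map 0) ?size_tuple//.
  have -> : [tuple tnth r (p i) | i < d]`_j = tnth r (p j).
    by rewrite -tnth_nth tnth_mktuple.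
  by rewrite sqr_sqrtr.
exists (row_perm p P).
  rewrite row_permE; apply: mul_unitarymx Pu; apply/unitarymxP.
  by rewrite tr_perm_mx map_perm_mx -perm_mxM mulgV perm_mx1.
apply/matrixP => a b; rewrite SE invmx_unitary//.
rewrite !mul_mx_diag !mxE (reindex_inj (@perm_inj _ p)).
apply: eq_bigr => i _; rewrite !mxE; congr (_ * _ * _).
by rewrite singvalE rE.
Qed.

Lemma singval_ge0 d (T : 'M[R]_d) j : 0 <= singval T j.
Proof.
rewrite /singval /singvals; set s := rev _.
have [js|sj] := ltnP j (size s); last by rewrite nth_default// size_map.
by rewrite (nth_map 0)// sqrtr_ge0.
Qed.

Lemma singval_nonincr d (T : 'M[R]_d) i j :
  (i <= j)%N -> singval T j <= singval T i.
Proof.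
(* Past the end of the list the default value is 0. *)
move=> ij; have [js|sj] := ltnP j (size (singvals T)); last first.
  by rewrite {1}/singval nth_default// singval_ge0.
have si := leq_ltn_trans ij js.
rewrite /singval /singvals in si js *; rewrite !size_map in si js.
rewrite !(nth_map 0)//; apply: ler_wsqrtr.
have : sorted >=%R (rev (eigvals_mult (T^T *m T))).
  by rewrite rev_sorted eigvals_mult_sorted.
by move=> /(sorted_leq_nth (rev_trans le_trans) (@lexx _ _) 0); apply.
Qed.

(** * Variational bounds and singular values of products *)

Local Notation sqnorm v := ((v *m v^t*) 0 0).
Local Notation gram T := (map_mx toC (T^T *m T)).
Local Notation form S v := ((v *m S *m v^t*) 0 0).

Lemma form_diag_mx d (D : 'rV[R[i]]_d) (z : 'rV[R[i]]_d) :
  form (diag_mx D) z = \sum_k D 0 k * (z 0 k * (z 0 k)^*).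
Proof.
by rewrite mul_mx_diag mxE; apply: eq_bigr => k _; rewrite !mxE mulrAC mulrC.
Qed.

Lemma sqnormE d (z : 'rV[R[i]]_d) : sqnorm z = \sum_k z 0 k * (z 0 k)^*.
Proof. by rewrite mxE; apply: eq_bigr => k _; rewrite !mxE. Qed.

(* The half of Courant-Fischer that is used: two subspaces of dimensions j + 1
   and d - j on which the Gram form is bounded below, respectively above, by
   the square of [singval T j]. *)
Lemma singval_minmax d (T : 'M[R]_d) (j : 'I_d) :
  exists WV : 'M[R[i]]_d * 'M[R[i]]_d,
  [/\ \rank WV.1 = j.+1, \rank WV.2 = (d - j)%N,
    forall v : 'rV_d, (v <= WV.1)%MS ->
      toC (singval T j ^+ 2) * sqnorm v <= form (gram T) v &
    forall v : 'rV_d, (v <= WV.2)%MS ->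
      form (gram T) v <= toC (singval T j ^+ 2) * sqnorm v].
Proof.
have [U Uu SE] := singval_spectral T.
have Ufree : row_free U by rewrite row_free_unit unitarymx_unit.
have formE (z : 'rV_d) : form (gram T) (z *m U) =
    \sum_(k < d) toC (singval T k ^+ 2) * (z 0 k * (z 0 k)^*).
  rewrite SE trmx_mul map_mxM !mulmxA mulmxtVK// mulmxtVK// form_diag_mx.
  by apply: eq_bigr => k _; rewrite mxE.
have normE (z : 'rV_d) : toC (singval T j ^+ 2) * sqnorm (z *m U) =
    \sum_(k < d) toC (singval T j ^+ 2) * (z 0 k * (z 0 k)^*).
  by rewrite trmx_mul map_mxM !mulmxA mulmxtVK// sqnormE mulr_sumr.
(* The rows of U are eigenvectors in decreasing order of singular value: W is spanned by rows 0 to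
   j, V by the rows from j on. *)
exists (pid_mx j.+1 *m U, copid_mx j *m U); split => /=.
- by rewrite mxrankMfree// rank_pid_mx.
- by rewrite mxrankMfree// rank_copid_mx// ltnW.
- move=> v /submxP[y ->]; rewrite mulmxA formE normE.
  apply: ler_sum => k _; have [kj|jk] := leqP k j.
    rewrite ler_wpM2r ?mul_conjC_ge0// lecR ler_sqr ?nnegrE ?singval_ge0//.
    exact: singval_nonincr.
  suff -> : (y *m pid_mx j.+1 : 'rV[R[i]]_d) 0 k = 0 by rewrite !mul0r !mulr0.
  rewrite mxE big1// => i _; rewrite mxE.
  case: eqP => [ik|]; last by rewrite mulr0.
  by rewrite ik ltnNge jk mulr0.
- move=> v /submxP[y ->]; rewrite mulmxA formE normE.
  apply: ler_sum => k _; have [jk|kj] := leqP j k.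
    rewrite ler_wpM2r ?mul_conjC_ge0// lecR ler_sqr ?nnegrE ?singval_ge0//.
    exact: singval_nonincr.
  suff -> : (y *m copid_mx j : 'rV[R[i]]_d) 0 k = 0 by rewrite !mul0r !mulr0.
  rewrite mxE big1// => i _; rewrite !mxE -val_eqE.
  by case: eqP => [->|]; rewrite ?kj /= subrr mulr0.
Qed.

Lemma form_gram d (T : 'M[R]_d) (v : 'rV[R[i]]_d) :
  form (gram T) v = sqnorm (v *m (map_mx toC T)^t*).
Proof.
rewrite trmxC_toC trmx_mul [in RHS]map_mxM /= trmxC_toC trmxK.
by rewrite map_mxM /= !mulmxA.
Qed.

Lemma sqnorm_gt0 d (v : 'rV[R[i]]_d) : v != 0 -> 0 < sqnorm v.
Proof. by move=> v0; rewrite -dotmxE dnorm_gt0. Qed.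

(* [rank W + rank V > d], so some nonzero vector of W is mapped into V by B^T;
   compare the two bounds on the form of A *m B at that vector. *)
Lemma singval_mulmx d (A B : 'M[R]_d) (j : nat) : (j < d)%N ->
  singval (A *m B) j <= singval A j * singval B 0.
Proof.
move=> jd; have d0 : (0 < d)%N by exact: leq_trans jd.
have [[W _] /= [rW _ qW _]] := singval_minmax (A *m B) (Ordinal jd).
have [[_ V] /= [_ rV _ qV]] := singval_minmax A (Ordinal jd).
have [[_ Z] /= [_ rZ _ qZ]] := singval_minmax B (Ordinal d0).
(* K consists of the row vectors that B^T maps into V; its rank is at least d - j, while W has rank
   j + 1. *)
pose Bt := map_mx toC B^T; pose K := kermx (Bt *m cokermx V).
have : (W :&: K)%MS != 0.
  rewrite -mxrank_eq0 -lt0n.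
  have := mxrank_sum_cap W K; have := rank_leq_col (W + K)%MS.
  have := mxrankM_maxr Bt (cokermx V); rewrite mxrank_coker rV rW /=.
  rewrite [\rank K]mxrank_ker.
  move: (\rank (Bt *m _)) (\rank (W + K)%MS) (\rank (W :&: K)%MS) => a b c.
  lia.
move=> /rowV0Pn[v]; rewrite sub_capmx => /andP[vW vK] v0.
have vBV : (v *m Bt <= V)%MS.
  by rewrite submxE; move/sub_kermxP: vK; rewrite mulmxA => ->.
(* At index 0 the second subspace has rank d, so its bound holds for every vector. *)
have vZ : (v <= Z)%MS.
  by rewrite submx_full// /row_full rZ subn0.
have := qW v vW; rewrite form_gram map_mxM trmx_mul map_mxM mulmxA.
rewrite !trmxC_toC -[map_mx toC A^T]trmxC_toC -form_gram.
move=> /le_trans/(_ (qV _ vBV)).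
have := qZ v vZ; rewrite form_gram trmxC_toC -/Bt => h1 h2.
have : toC (singval (A *m B) j ^+ 2) <=
    toC (singval A j ^+ 2 * singval B 0 ^+ 2).
  rewrite -(ler_pM2r (sqnorm_gt0 v0)); apply: (le_trans h2).
  by rewrite [in leRHS]rmorphM/= -[leRHS]mulrA ler_wpM2l// ler0c sqr_ge0.
by rewrite lecR -exprMn ler_sqr ?nnegrE ?mulr_ge0 ?singval_ge0.
Qed.

Lemma singval1 d (j : nat) : (j < d)%N -> singval (1%:M : 'M[R]_d) j <= 1.
Proof.
move=> jd; have [[W _] /= [rW _ qW _]] := singval_minmax 1%:M (Ordinal jd).
have /rowV0Pn[v vW v0] : W != 0 by rewrite -mxrank_eq0 rW.
have := qW v vW; rewrite trmx1 mulmx1 map_mx1 mulmx1.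
rewrite -{2}[sqnorm v]mul1r ler_pM2r ?sqnorm_gt0// (_ : 1 = toC 1)//.
by rewrite lecR expr_le1// singval_ge0.
Qed.

(** * The singular value function *)

Lemma truncn_ler (s : R) : 0 <= s -> (Num.truncn s)%:R <= s.
Proof. by rewrite truncn_le. Qed.

Lemma svf_ge0 d s (T : 'M[R]_d) : 0 <= svf s T.
Proof.
by rewrite mulr_ge0 ?powR_ge0// prodr_ge0// => *; exact: singval_ge0.
Qed.

Lemma le_svf d s (A B : 'M[R]_d) : (0 < d)%N -> 0 <= s ->
  (forall j, (j < d)%N -> singval A j <= singval B j) -> svf s A <= svf s B.
Proof.
move=> d0 s0 AB; rewrite /svf; set k := minn _ _.
have kd : (k < d)%N by rewrite /k; lia.
have ks : k%:R <= s by rewrite (le_trans _ (truncn_ler s0))// ler_nat geq_minl.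
apply: ler_pM.
- by apply: prodr_ge0 => *; exact: singval_ge0.
- exact: powR_ge0.
- apply: ler_prod => i _; rewrite singval_ge0 AB//.
  exact: ltn_trans (ltn_ord i) kd.
- by apply: ge0_ler_powR; rewrite ?nnegrE ?subr_ge0 ?singval_ge0 ?AB.
Qed.

(* The upper bound on t keeps the same number of full factors in both singular
   value functions, so only the exponent of the last one changes. *)
Lemma svf_le_exponent d s t c (A : 'M[R]_d) : (0 < d)%N -> 0 <= s ->
  s < t < (Num.truncn s).+1%:R ->
  (forall j, (j < d)%N -> singval A j <= c) ->
  svf t A <= svf s A * c `^ (t - s).
Proof.
move=> d0 s0 /andP[st tS] Ac; have t0 := le_trans s0 (ltW st).
have tE : Num.truncn t = Num.truncn s.
  by apply/truncn_def; rewrite tS andbT (le_trans (truncn_ler s0))// ltW.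
rewrite /svf tE; set k := minn _ _.
have kd : (k < d)%N by rewrite /k; lia.
have ks : k%:R <= s by rewrite (le_trans _ (truncn_ler s0))// ler_nat geq_minl.
have tkE : t - k%:R = (s - k%:R) + (t - s) by ring.
(* Adding exponents of [powR] requires a nonzero base or a nonzero total exponent; here t - k >
   0. *)
rewrite tkE [in leLHS]powRD; last first.
  by rewrite -tkE gt_eqF// subr_gt0 (le_lt_trans ks).
rewrite mulrA; apply: ler_wpM2l; first exact: svf_ge0.
apply: ge0_ler_powR; rewrite ?nnegrE ?singval_ge0 ?Ac ?subr_ge0 ?(ltW st)//.
exact: le_trans (singval_ge0 _ _) (Ac _ kd).
Qed.

End Singval.

(** * Sums and limits *)

(** Makes the monoid lemmas on iterated operators available for the ordered product in
    [word_lin]. *)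
HB.instance Definition _ (R : pzRingType) n := Monoid.isLaw.Build 'M[R]_n 1%:M
  (@mulmx R n n n) (@mulmxA R n n n n) (@mul1mx R n n) (@mulmx1 R n n).

Lemma esum_subset (R : realType) (T : choiceType) (A B : set T)
    (a : T -> \bar R) : A `<=` B -> (forall x, 0 <= a x)%E ->
  (\esum_(i in A) a i <= \esum_(i in B) a i)%E.
Proof.
move=> /setIidr AB a0; rewrite -AB esum_mkcondr; apply: le_esum => x _.
by case: ifP.
Qed.

(** The sets [J k] may overlap; choosing one index [g x] for each x in A injects A into their
    disjoint union. *)
Lemma esum_bigcup_le (R : realType) (T I : choiceType) (A : set T) (K : set I)
    (J : I -> set T) (a : T -> \bar R) :
  A `<=` \bigcup_(k in K) J k -> (forall x, 0 <= a x)%E ->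
  (\esum_(i in A) a i <= \esum_(k in K) \esum_(i in J k) a i)%E.
Proof.
move=> AJ a0; rewrite esum_esum//.
have [->|/set0P[x0 Ax0]] := eqVneq A set0.
  by rewrite esum_set0; exact: esum_ge0.
have [k0 _ _] := AJ _ Ax0.
pose g x := xget k0 [set k | K k /\ J k x].
have gP x : A x -> K (g x) /\ J (g x) x.
  move=> /AJ[k Kk Jkx].
  exact: (xgetPex k0 (ex_intro (fun k => K k /\ J k x) k (conj Kk Jkx))).
rewrite -(@esum_image _ _ _ A (fun x => (g x, x)) (fun k => a k.2)); last first.
  by move=> x y _ _ [].
by apply: esum_subset => // _ [x Ax <-]; exact: gP.
Qed.

Lemma esum_finType (R : realType) (T : finType) (a : T -> \bar R) :
  (forall x, 0 <= a x)%E -> (\esum_(x in [set: T]) a x = \sum_x a x)%E.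
Proof.
move=> a0; rewrite esum_fset//; last exact: finite_finset.
rewrite (fsbigE (index_enum T)) ?index_enum_uniq//; last first.
  by move=> i _; rewrite mem_index_enum.
by apply: eq_bigl => x; rewrite in_setT.
Qed.

(** Provides the K for which q^K compensates the M choices of each added letter. *)
Lemma geometric_small (R : realType) (M : nat) (q : R) :
  0 < q < 1 -> exists K : nat, M%:R * q ^+ K <= 1.
Proof.
move=> /andP[q0 q1].
have : M%:R * q ^+ n @[n --> \oo] --> M%:R * (0 : R).
  by apply: cvgMr; apply: cvg_expr; rewrite gtr0_norm.
rewrite mulr0 => /cvgrPdist_le/(_ 1 ltr01)[K _ /(_ K (leqnn K))] /=.
rewrite sub0r normrN ger0_norm ?mulr_ge0 ?exprn_ge0 ?(ltW q0)// => MqK.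
by exists K.
Qed.

Lemma exprn_powR (R : realType) (x e : R) n :
  0 <= x -> (x ^+ n) `^ e = (x `^ e) ^+ n.
Proof.
move=> x0; rewrite -powR_mulrn// -powRrM mulrC powRrM powR_mulrn//.
exact: powR_ge0.
Qed.

(** The limit is the supremum. Hence a net measure vanishes exactly when all its cover infima do. *)
Lemma limn_nondecreasing_eq0 (R : realType) (u : nat -> \bar R) :
  {homo u : m n / (m <= n)%N >-> (m <= n)%E} -> (forall n, 0 <= u n)%E ->
  limn u = 0%E <-> forall n, u n = 0%E.
Proof.
move=> u_nd u0; split=> [|u00]; last first.
  by rewrite (_ : u = cst 0%E) ?lim_cst//; exact/funext.
rewrite (cvg_lim _ (ereal_nondecreasing_cvgn u_nd))// => sup0 n.
apply/eqP; rewrite eq_le u0 andbT -sup0.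
by apply: ereal_sup_ubound; exists n.
Qed.

(** * Covers by neck words *)

Section Covers.
Context (R : realType) (d : nat) (L : ptopologicalType).
Variable F : affine_family R d L.
Hypothesis d_gt0 : (0 < d)%N.
Local Notation Omega := (necked_tree F).
Implicit Types (om : Omega) (w : seq nat) (s t : R).

Lemma words_cat om w v : words om (w ++ v) -> words om w.
Proof. exact: tree_cat. Qed.

Lemma word_lin_rcons om w i : word_lin om (rcons w i) =
  word_lin om w *m lin F (odflt point (tree om w)) i.
Proof.
rewrite /word_lin size_rcons big_ord_recr /= nth_rcons ltnn eqxx.
rewrite -cats1 take_size_cat//; congr (_ *m _).
by apply: eq_bigr => k _; rewrite nth_cat ltn_ord takel_cat// ltnW.
Qed.

Lemma words_all om w M : (forall l, nmaps F l <= M)%N -> words om w ->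
  all (fun i => i < M)%N w.
Proof.
move=> FM; elim/last_ind: w => //= w i IH; rewrite all_rcons /words /=.
rewrite (tree_code om).2; case E : (tree om w) => [l|//] il.
rewrite IH ?andbT; last by rewrite /words /= E.
exact: leq_trans il (FM l).
Qed.

Variable c : R.
Hypothesis c01 : 0 < c < 1.
Hypothesis singval_le : forall l i j, (i < nmaps F l)%N -> (j < d)%N ->
  singval (lin F l i) j <= c.

Lemma singval_word_rcons om w i j : words om (rcons w i) -> (j < d)%N ->
  singval (word_lin om (rcons w i)) j <= singval (word_lin om w) j * c.
Proof.
move=> wi jd; rewrite word_lin_rcons; apply: le_trans (singval_mulmx _ _ jd) _.
apply: ler_wpM2l; first exact: singval_ge0.
move: wi; rewrite /words /= (tree_code om).2; case: (tree om w) => // l il.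
exact: singval_le.
Qed.

Lemma singval_word_le om w j : words om w -> (j < d)%N ->
  singval (word_lin om w) j <= c ^+ size w.
Proof.
move=> + jd; elim/last_ind: w => [_|w i IH wi].
  by rewrite /word_lin big_ord0 expr0 singval1.
apply: le_trans (singval_word_rcons wi jd) _; rewrite size_rcons exprSr.
rewrite ler_wpM2r ?IH//; first by case/andP: c01 => /ltW.
by move: wi; rewrite -cats1 => /words_cat.
Qed.

Lemma svf_word_cat om w v s : 0 <= s -> words om (w ++ v) ->
  svf s (word_lin om (w ++ v)) <= svf s (word_lin om w).
Proof.
move=> s0; elim/last_ind: v => [|v i IH]; first by rewrite cats0.
rewrite -rcons_cat => wvi.
have wv : words om (w ++ v) by move: wvi; rewrite -cats1 => /words_cat.
apply: le_trans (IH wv); apply: le_svf => // j jd.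
apply: le_trans (singval_word_rcons wvi jd) _.
by rewrite ler_piMr ?singval_ge0//; case/andP: c01 => _ /ltW.
Qed.

Variable M : nat.
Hypothesis nmaps_le : forall l, (nmaps F l <= M)%N.

Definition extensions om w l : set (seq nat) :=
  words om `&` [set u | exists2 v, u = w ++ v & size v = l].

(** An extension is determined by l letters below M, and appending letters does not increase the
    singular value function. *)
Lemma esum_extensions om w l t : 0 <= t ->
  (\esum_(u in extensions om w l) (svf t (word_lin om u))%:E <=
    ((M ^ l)%:R * svf t (word_lin om w))%:E)%E.
Proof.
(* A tuple may lead out of the tree; its set is then empty and contributes 0. *)
move=> t0; pose J (p : l.-tuple 'I_M) := [set w ++ map val p] `&` words om.
have cov : extensions om w l `<=` \bigcup_(p in setT) J p.
  move=> u [/[swap] [[v -> vl]] wv].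
  have vM : all (fun i => i < M)%N v.
    by have := words_all nmaps_le wv; rewrite all_cat => /andP[].
  have sz : size (pmap (insub : nat -> option 'I_M) v) == l.
    by rewrite size_pmap_sub -vl -all_count.
  exists (Tuple sz) => //; split => //=; congr (_ ++ _).
  rewrite /= (pmap_filter (insubK _)); apply/esym/all_filterP.
  by apply: sub_all vM => i iM; rewrite insubT.
have svf0 u : (0 <= (svf t (word_lin om u))%:E)%E by rewrite lee_fin svf_ge0.
apply: le_trans (esum_bigcup_le cov svf0) _.
apply: (@le_trans _ _ (\esum_(p in [set: l.-tuple 'I_M])
    (svf t (word_lin om w))%:E)%E).
  apply: le_esum => p _; rewrite /J esum_mkcondr esum_set1; last by case: ifP.
  case: ifPn => [/set_mem wp|_]; last exact: svf0.
  by rewrite lee_fin svf_word_cat.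
rewrite esum_finType; last by move=> _; exact: svf0.
by rewrite sumEFin sumr_const card_tuple card_ord mulr_natl.
Qed.

Lemma neck_ge om m : (m <= neck om m)%N.
Proof. by elim: m => // m IH; exact: leq_ltn_trans IH (neck_incr om m). Qed.

Lemma next_neck om n : (0 < n)%N ->
  exists m, (neck om m < n <= neck om m.+1)%N.
Proof.
move=> n0; have [|[|m] nm mmin] := ex_minnP (P := fun m => n <= neck om m)%N.
- by exists n; exact: neck_ge.
(* The least m is positive because N_0 = 0 < n. *)
- by move: nm; rewrite neck0 leqNgt n0.
- exists m; rewrite nm andbT ltnNge; apply/negP => /mmin.
  by rewrite ltnn.
Qed.

(** The gaps are o(n), with K in the role of 1/epsilon so that everything stays in the natural
    numbers. *)
Definition sparse_necks om := forall K : nat, exists n0 : nat,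
  forall n, (n0 <= n)%N -> (K * (neck om n.+1 - neck om n) <= n)%N.

(** With q = c^(t - s), raising the exponent gains at least q^(K l) since |w| >= K l, and M^l q^(K
    l) = (M q^K)^l <= 1. *)
Lemma card_extensions_le om w s t K l : 0 <= s ->
  s < t < (Num.truncn s).+1%:R -> M%:R * (c `^ (t - s)) ^+ K <= 1 ->
  (K * l <= size w)%N -> words om w ->
  (M ^ l)%:R * svf t (word_lin om w) <= svf s (word_lin om w).
Proof.
move=> s0 st MK Klw ww.
have /andP[c0 c1] := c01.
have w_le j : (j < d)%N -> singval (word_lin om w) j <= c ^+ (K * l).
  move=> jd; apply: le_trans (singval_word_le ww jd) _.
  by rewrite ler_wiXn2l// ltW.
have := svf_le_exponent d_gt0 s0 st w_le.
have -> : (c ^+ (K * l)) `^ (t - s) = ((c `^ (t - s)) ^+ K) ^+ l.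
  by rewrite exprn_powR ?(ltW c0)// exprM.
set q := _ ^+ K => h.
apply: le_trans (ler_wpM2l _ h) _; first exact: ler0n.
rewrite mulrCA ler_piMr ?svf_ge0// natrX -exprMn exprn_ile1//.
by rewrite mulr_ge0// exprn_ge0// powR_ge0.
Qed.

(** Replacing each w of a cover by all its extensions to the next neck level gives a neck cover
    whose sum at t is at most the old sum at s. *)
Lemma cover_inf_neck_le om s t j : 0 <= s ->
  s < t < (Num.truncn s).+1%:R -> sparse_necks om -> exists j',
  (cover_inf om t (neck_words om j) (rays om) <=
   cover_inf om s (words om `&` [set w | (j' <= size w)%N]) (rays om))%E.
Proof.
move=> s0 st sp; have t0 : 0 <= t by case/andP: st => /ltW/(le_trans s0).
have /andP[c0 c1] := c01.
have one_powR : 1 `^ (t - s) = 1 :> R by rewrite powR1.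
have q01 : 0 < c `^ (t - s) < 1.
  rewrite powR_gt0//= -[ltRHS]one_powR.
  by case/andP: st => st _; rewrite gt0_ltr_powR ?subr_gt0 ?nnegrE// ltW.
have [K MK] := geometric_small M q01.
have [n0 n0P] := sp K.
(* For words at least this long, the last neck strictly before the end has index at least j and n0:
   the new words are then admissible and the gap bound applies. *)
exists (neck om (maxn j n0).+1).
apply: le_ereal_inf_tmp => _ [J [Jw Jcov] <-].
have /choice[m mP] : forall n, exists m, (0 < n)%N ->
    (neck om m < n <= neck om m.+1)%N.
  (* The value at length 0 is arbitrary; all words of J are nonempty. *)
  by case=> [|n]; [exists 0%N|have [m] := next_neck om (ltn0Sn n); exists m].
pose l w := (neck om (m (size w)).+1 - size w)%N.
have Jm w : J w -> (neck om (m (size w)) < size w <= neck om (m (size w)).+1)%N.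
  move=> /Jw[_ /= wj]; apply: mP; apply: leq_trans wj.
  exact: leq_trans (neck_ge _ _).
have mge w : J w -> (maxn j n0 <= m (size w))%N.
  move=> Jw'; have [_ /= wj] := Jw _ Jw'; have /andP[_ wm] := Jm _ Jw'.
  rewrite leqNgt; apply/negP => lt.
  have := leq_trans (leq_trans wj wm) (neck_leq om lt).
  by rewrite leqNgt neck_incr.
apply: (@le_trans _ _ (\esum_(u in \bigcup_(w in J) extensions om w (l w))
    (svf t (word_lin om u))%:E)%E).
  apply: ereal_inf_lbound.
  exists (\bigcup_(w in J) extensions om w (l w)) => //.
  split=> [u [w Jw' [/[swap] [[v -> vl]] wv]]|r rr].
    split=> //; exists (m (size w)).+1.
      by have := mge _ Jw'; rewrite geq_max => /andP[/leqW].
    by rewrite size_cat vl subnKC//; case/andP: (Jm _ Jw').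
  (* A ray through w also passes through its own prefix at the next neck level, which is one of the
     extensions of w. *)
  have [w Jw' [_ rw]] := Jcov _ rr.
  have rE : prefix_of r (size w + l w) = w ++ map r (iota (size w) (l w)).
    by rewrite /prefix_of /mkseq iotaD map_cat; congr (_ ++ _).
  exists (prefix_of r (size w + l w)).
    exists w => //; split; first exact: rr.
    rewrite rE; exists (map r (iota (size w) (l w))) => //.
    by rewrite size_map size_iota.
  by split=> //; rewrite size_mkseq.
apply: le_trans (esum_bigcup_le (@subset_refl _ _) _) _.
  by move=> u; rewrite lee_fin svf_ge0.
apply: le_esum => w Jw'; apply: le_trans (esum_extensions _ _ _ t0) _.
rewrite lee_fin; apply: (card_extensions_le s0 st MK); last first.
  by have [] := Jw _ Jw'.
have /andP[mw wm] := Jm _ Jw'.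
have h := n0P (m (size w)) (leq_trans (leq_maxr j n0) (mge _ Jw')).
(* With m = [m (size w)]: K l <= K (N_(m+1) - N_m) <= m <= N_m < |w|. *)
apply: leq_trans (leq_trans h (leq_trans (neck_ge om _) (ltnW mw))).
by rewrite leq_mul2l leq_sub2l ?orbT// ltnW.
Qed.

End Covers.

(** * Comparison of the two dimensions *)

Section Dimensions.
Context (R : realType) (d : nat) (L : ptopologicalType).
Variable F : affine_family R d L.
Hypothesis d_gt0 : (0 < d)%N.
Local Notation Omega := (necked_tree F).
Implicit Types (om : Omega) (w : seq nat) (s t : R).

Lemma cover_inf_ge0 om s A E : (0 <= cover_inf om s A E)%E.
Proof.
apply: le_ereal_inf_tmp => _ [J _ <-].
by apply: esum_ge0 => w _; rewrite lee_fin svf_ge0.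
Qed.

Lemma le_cover_inf om s A B E :
  A `<=` B -> (cover_inf om s B E <= cover_inf om s A E)%E.
Proof.
move=> AB; apply: ereal_inf_le_tmp; apply: image_subset => J [JA ?].
by split=> //; exact: subset_trans AB.
Qed.

Lemma net_measure_eq0 om s E : net_measure om s E = 0%E <-> forall j,
  cover_inf om s (words om `&` [set w | (j <= size w)%N]) E = 0%E.
Proof.
apply: limn_nondecreasing_eq0 => [m n mn|n]; last exact: cover_inf_ge0.
by apply: le_cover_inf => w [? /= ?]; split=> //=; exact: leq_trans mn _.
Qed.

Lemma neck_net_measure_eq0 om s E : neck_net_measure om s E = 0%E <->
  forall j, cover_inf om s (neck_words om j) E = 0%E.
Proof.
apply: limn_nondecreasing_eq0 => [m n mn|n]; last exact: cover_inf_ge0.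
apply: le_cover_inf => w [? /= [k nk ?]]; split=> //=.
by exists k => //; exact: leq_trans mn _.
Qed.

Lemma affinity_dim_le om : (affinity_dim om <= neck_affinity_dim om)%E.
Proof.
apply: ereal_inf_le_tmp; apply: image_subset => s [s0].
move=> /neck_net_measure_eq0 sE; split=> //; apply/net_measure_eq0 => j.
apply/eqP; rewrite eq_le cover_inf_ge0 andbT -(sE j).
apply: le_cover_inf => w [? /= [k jk ->]]; split=> //=.
exact: leq_trans jk (neck_ge om k).
Qed.

Lemma neck_affinity_dim_le om : sparse_necks om ->
  (neck_affinity_dim om <= affinity_dim om)%E.
Proof.
move=> sp; have [M nmaps_le] := nmaps_bounded F.
have [lo [c [_ c01 svF]]] := singval_bounded F.
have singval_le l i j : (i < nmaps F l)%N -> (j < d)%N ->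
    singval (lin F l i) j <= c.
  by move=> il jd; have /andP[] := svF l i j il jd.
apply: le_ereal_inf_tmp => _ [s [s0 /net_measure_eq0 sE] <-].
apply/lee_addgt0Pr => e e0.
have sS := truncnS_gt s.
(* This t exceeds s by at most e and stays below the next integer, as the exponent change
   requires. *)
pose t := Num.min (s + e) ((s + (Num.truncn s).+1%:R) / 2).
have st : s < t < (Num.truncn s).+1%:R.
  by rewrite /t lt_min ltrDl e0 midf_lt//= gt_min (midf_lt sS) orbT.
apply: (@le_trans _ _ t%:E); last by rewrite -EFinD lee_fin ge_min lexx.
apply: ereal_inf_lbound; exists t => //; split.
  by case/andP: st => /ltW/(le_trans s0).
apply/neck_net_measure_eq0 => j; apply/eqP.
have [j' le] := cover_inf_neck_le d_gt0 c01 singval_le nmaps_le j s0 st sp.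
by rewrite eq_le cover_inf_ge0 andbT (le_trans le)// sE.
Qed.

End Dimensions.

(** * Almost sure sparsity of the necks *)

Lemma measurable_preimage_iter (T : ptopologicalType) (f : T -> T) n
    (A : set (borelType T)) :
  continuous f -> measurable A ->
  measurable (iter n f @^-1` A : set (borelType T)).
Proof.
move=> /continuousP cf; elim: n A => // n IH A mA.
have mf : measurable_fun setT (f : borelType T -> borelType T).
  refine (@measurability _ _ (borelType T) (borelType T) _ f open _ _) => //.
  by move=> _ [B oB <-]; rewrite setTI; apply: sub_sigma_algebra; exact: cf.
rewrite (_ : _ @^-1` _ = iter n f @^-1` (f @^-1` A))//; apply: IH.
by rewrite -[X in measurable X]setTI; exact: mf.
Qed.

Lemma measure_preimage_iter (R : realType) (T : ptopologicalType) (f : T -> T)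
    (P : probability (borelType T) R) n (A : set (borelType T)) :
  continuous f -> invariant_measure P f -> measurable A ->
  P (iter n f @^-1` A) = P A.
Proof.
move=> cf Pf mA; elim: n => // n IH.
rewrite -IH -(Pf _ (measurable_preimage_iter n cf mA)); congr (P _).
by apply/seteqP; split=> x /=; rewrite -iterSr.
Qed.

(** Writes m as a sum of indicators, which links the expectation of N_1 to a series of tail
    probabilities. *)
Lemma nneseries_ltn (R : realType) (m : nat) :
  (\sum_(0 <= n <oo) ((n < m)%N%:R : R)%:E = m%:R%:E)%E.
Proof.
rewrite (nneseries_split 0 m); last by move=> k _; rewrite lee_fin ler0n.
rewrite add0n [X in (_ + X)%E]eseries0 ?adde0; last first.
  by move=> k mk _ /=; rewrite ltnNge mk.
under eq_big_nat => k /= km do rewrite km.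
by rewrite sumEFin big_const_nat iter_addr_0 subn0.
Qed.

Section Sparse.
Context (R : realType) (d : nat) (L : ptopologicalType).
Variable F : affine_family R d L.
Local Notation Omega := (necked_tree F).
Local Notation shift := (@neck_shift R d L F).

(** The differences telescope. For m = 1 this is the n-th gap, so each gap is N_1 along the orbit of
    the shift. *)
Lemma neck_iter_shift (om : Omega) n m :
  neck (iter n shift om) m = (neck om (m + n) - neck om n)%N.
Proof.
elim: n om => [|n IH] om; first by rewrite neck0 subn0 addn0.
rewrite iterSr IH /= /shift_neck addnS.
have := neck_leq om (ltn0Sn n); have := neck_leq om (ltn0Sn (m + n)).
lia.
Qed.

(** A condition on N_1 alone defines a union of cylinders of depth 1, which is open. *)
Lemma measurable_neck1 (p : set nat) :
  measurable ([set om : Omega | p (neck om 1)] : set (borelType Omega)).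
Proof.
apply: sub_sigma_algebra.
rewrite (_ : [set om | _] =
    \bigcup_(om in [set om : Omega | p (neck om 1)]) cylinder (om, 1%N)).
  by apply: bigcup_open => om _; exact: cylinder_open.
apply/seteqP; split=> [om pom|om' [om pom [/(_ 1%N isT) /= + _]]].
  by exists om.
by move=> /= ->.
Qed.

Variable P : probability (borelType Omega) R.
Hypothesis P_inv : invariant_measure P shift.
Hypothesis neck1_integrable :
  (\int[P]_(om in setT) ((neck om 1)%:R)%:E < +oo)%E.

(** The event that the bound of [sparse_necks] for K fails at n. *)
Definition long_gap K n : set (borelType Omega) :=
  [set om | (n < K * (neck om n.+1 - neck om n))%N].

Lemma measurable_long_gap K n : measurable (long_gap K n) /\
  P (long_gap K n) = P [set om | (n < K * neck om 1)%N].
Proof.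
have m1 := measurable_neck1 [set k | (n < K * k)%N].
have -> : long_gap K n = iter n shift @^-1` [set om | (n < K * neck om 1)%N].
  by apply/seteqP; split=> om /=; rewrite /long_gap/= neck_iter_shift add1n.
have shift_cont := @neck_shift_continuous _ _ _ F.
split; first exact: measurable_preimage_iter shift_cont m1.
exact: measure_preimage_iter shift_cont P_inv m1.
Qed.

Lemma measurable_fun_neck1 (g : nat -> \bar R) :
  @measurable_fun _ _ (borelType Omega) (\bar R) setT
    (fun om => g (neck (om : Omega) 1)).
Proof.
move=> _ B mB; rewrite setTI.
exact: (measurable_neck1 [set k | B (g k)]).
Qed.

(* The $n$-th gap is $N_1 \circ \Xi^n$, so by invariance the series of the
   probabilities is at most $K \int N_1 \, dP$ and Borel-Cantelli applies. *)
Lemma lim_sup_long_gap K : P (lim_sup_set (long_gap K)) = 0%E.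
Proof.
apply: lim_sup_set_cvg0 => [n|]; first exact: (measurable_long_gap K n).1.
have -> : (\sum_(0 <= n <oo) P (long_gap K n) =
    \sum_(0 <= n <oo) \int[P]_(om in setT)
      ((n < K * neck (om : Omega) 1)%N%:R : R)%:E)%E.
  apply: eq_eseriesr => n _; rewrite (measurable_long_gap K n).2.
  rewrite -[X in P X]setIT -integral_indic//; last first.
    exact: (measurable_neck1 [set k | (n < K * k)%N]).
  apply: eq_integral => om _; rewrite indicE; congr (nat_of_bool _)%:R%:E.
  by apply/idP/idP => [/set_mem//|?]; exact/mem_set.
rewrite -integral_nneseries//; last first.
  by move=> n; exact: (measurable_fun_neck1 (fun k => (n < K * k)%N%:R%:E)).
(* For fixed [om], the number of n below K N_1 is K N_1 itself. *)
under eq_integral do rewrite nneseries_ltn natrM EFinM.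
rewrite ge0_integralZl//; last exact: (measurable_fun_neck1 (fun k => k%:R%:E)).
by rewrite lte_mul_pinfty.
Qed.

Lemma ae_sparse_necks : {ae P, forall om : Omega, sparse_necks om}.
Proof.
apply: (@negligibleS _ _ _ _ (\bigcup_K lim_sup_set (long_gap K))); last first.
  apply: negligible_bigcup => K; apply/negligibleP; last first.
    exact: lim_sup_long_gap.
  apply: bigcap_measurable => // n _; apply: bigcup_measurable => k _.
  exact: (measurable_long_gap K k).1.
(* If no threshold works for K, then beyond every n there is a long gap, so [om] lies in the upper
   limit of these events. *)
move=> om /= /existsNP[K nK]; exists K => // n _.
apply: contrapT => h; apply: nK; exists n => k nk.
by rewrite leqNgt; apply/negP => lt; apply: h; exists k.
Qed.

End Sparse.

Theorem proposition3p2 (R : realType) (d : nat) (L : ptopologicalType)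
    (F : affine_family R d L)
    (P : probability (borelType (necked_tree F)) R) :
  (0 < d)%N ->
  invariant_measure P (@neck_shift R d L F) ->
  ergodic P (@neck_shift R d L F) ->
  (\int[P]_(om in setT) ((neck om 1)%:R)%:E < +oo)%E ->
  {ae P, forall om : necked_tree F, affinity_dim om = neck_affinity_dim om}.
Proof.
move=> d0 Pinv _ neck1_int.
apply: negligibleS (ae_sparse_necks Pinv neck1_int) => om /=.
apply: contra_not => sp; apply/eqP.
by rewrite eq_le affinity_dim_le neck_affinity_dim_le.
Qed.
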